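(* Let $(D,\mathfrak S)$ be a crude linear series of rank $r$ on a metric graph $\Gamma$. Let $G=(V,E)$ be a model of $\Gamma$ such that $D$ is supported on $V$, and let $e=uv$ be an oriented edge of $G$. For each point $x$ on $e$ other than its head $v$, let $\nu$ denote the unit tangent vector at $x$ pointing along $e$ in the direction of its orientation, and let $s_0^\nu(x)<\dots<s_r^\nu(x)$ be the elements of the set $S^\nu$ given by $\mathfrak S$ for the tangent vector $\nu$ at $x$. Then the vector-valued function $x\mapsto(s_0^\nu(x),\dots,s_r^\nu(x))$ is coordinatewise non-increasing along $e$: for every such $x$ and every sufficiently small $\varepsilon>0$, denoting by $y=x+\varepsilon\nu$ the point at distance $\varepsilon$ from $x$ in the direction $\nu$, one has $$s_j^\nu(y)\le s_j^\nu(x)\qquad\text{for every } j=0,1,\dots,r,$$ and consequently $s_j^\nu(y)\le s_j^\nu(x)$ whenever $x$ precedes $y$ on $e$.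
   Context: Metric graphs. A metric graph $\Gamma$ is the metric realization of a pair $(G,\ell)$, where $G=(V,E)$ is a finite connected graph with at least one edge and $\ell\colon E\to\mathbb R_{>0}$: each edge $e$ is replaced by a closed interval of length $\ell(e)$, glued according to $G$, with the path metric. $G$ (with $\ell$) is called a model of $\Gamma$; a model is simple if it has no loops and no parallel edges. $\mathrm T_x(\Gamma)$ is the finite set of outgoing unit tangent vectors at $x$, and $d_x=|\mathrm T_x(\Gamma)|$. $\mathrm{Rat}(\Gamma)$ is the set of continuous piecewise affine functions $f\colon\Gamma\to\mathbb R$ with integral slopes; $\mathrm{slope}_\nu(f)$ is the outgoing slope of $f$ along $\nu$. A divisor $D$ is a finite formal integer combination of points of $\Gamma$, $D(x)$ is its coefficient at $x$, $D\ge 0$ (effective) means all coefficients are $\geq 0$. $\mathrm{div}(f)=\sum_x \mathrm{ord}_x(f)(x)$ with $\mathrm{ord}_x(f)=-\sum_{\nu\in \mathrm T_x(\Gamma)}\mathrm{slope}_\nu(f)$. Hypercube rank functions. Put $[r]=\{0,\dots,r\}$. The hypercube $[r]^\delta$ ($\delta\geq 1$) carries the coordinatewise order $\preceq$ and coordinatewise max $\vee$ and min $\wedge$; $\underline e_i$ is the $i$-th unit vector. A rank function is a map $\rho\colon[r]^\delta\to\mathbb Z$ such that: (1) $\rho(t\,\underline e_i)=r-t$ for all $i$ and $t\in[r]$; (2) $\underline a\preceq\underline b$ implies $\rho(\underline b)\le\rho(\underline a)$; (3) $\rho(\underline a)+\rho(\underline b)\le\rho(\underline a\vee\underline b)+\rho(\underline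 a\wedge\underline b)$; (4) $\rho$ takes values in $\{-1,0,\dots,r\}$. A jump of $\rho$ is a point $\underline a$ with $\rho(\underline a)\ge 0$ and $\rho(\underline a+\underline e_i)=\rho(\underline a)-1$ for every $i$ with $\underline a+\underline e_i\in[r]^\delta$. The standard rank function is $\rho(\underline a)=\max\{-1,r-a_1-\dots-a_\delta\}$. Slope structures. A slope structure $\mathfrak S$ of width $r$ on $\Gamma$ is the data, on some simple graph model $H=(V',E')$ of $\Gamma$, of: for every oriented edge $uv$, a set $S^{uv}$ of integers $s_0^{uv}<\dots<s_r^{uv}$ with $s_i^{uv}+s_{r-i}^{vu}=0$; for every $v\in V'$, a rank function $\rho_v$ on $[r]^{d_v}$, whose coordinates are indexed by the oriented edges with tail $v$ (equivalently by $\mathrm T_v(\Gamma)$). It is extended to all of $\Gamma$: for $\nu\in \mathrm T_x(\Gamma)$, $S^\nu=\{s_0^\nu<\dots<s_r^\nu\}$ is $S^{uv}$ for the oriented edge $uv$ of $H$ parallel to $\nu$; for $x\in\Gamma\setminus V'$, $\rho_x$ is the standard rank function on $[r]^2$. For $\underline a=(a_\nu)_\nu\in[r]^{\mathrm T_x(\Gamma)}$ put $s_{\underline a}=(s^\nu_{a_\nu})_\nu$, and let $S^x=\{s_{\underline a}:\underline a\text{ a jump of }\rho_x\}$. A function $f\in\mathrm{Rat}(\Gamma)$ is compatible with $\mathfrak S$ if for every $x\in\Gamma$, $\mathrm{slope}_\nu(f)\in S^\nu$ for all $\nu\in\mathrm T_x(\Gamma)$, and $\partial_x(f):=(\mathrm{slope}_\nu(f))_{\nu\in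 \mathrm T_x(\Gamma)}\in S^x$. If $\partial_x(f)=s_{\underline a}$, write $\rho_x(\partial_x(f)):=\rho_x(\underline a)$. $\mathrm{Rat}(D,\mathfrak S)$ is the set of $f\in\mathrm{Rat}(\Gamma)$ compatible with $\mathfrak S$ with $D+\mathrm{div}(f)\ge0$. A crude linear series of rank $r$ is a pair $(D,\mathfrak S)$ with $D$ a divisor and $\mathfrak S$ a slope structure of width $r$ on $\Gamma$ such that for every effective divisor $E$ of degree $r$ there is $f\in\mathrm{Rat}(D,\mathfrak S)$ with $\rho_x(\partial_x(f))\ge E(x)$ for all $x\in\Gamma$ and $D+\mathrm{div}(f)-E\ge0$. *)

(* Defs.v *)
From HB Require Import structures.
From mathcomp Require Import all_boot all_order all_algebra finmap.
From mathcomp Require Import boolp classical_sets reals.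

Set Implicit Arguments.
Unset Strict Implicit.
Unset Printing Implicit Defensive.

Import Order.TTheory GRing.Theory Num.Theory.
Local Open Scope classical_set_scope.
Local Open Scope ring_scope.

(* The pair (G, l).  The edge [e] carries the reference orientation from [src e]
   to [tgt e]; loops and parallel edges are allowed. *)
Record metric_graph (R : realType) := MetricGraph {
  vert : finType;
  edge : finType;
  src : edge -> vert;
  tgt : edge -> vert;
  len : edge -> R;
  len_gt0 : forall e, 0 < len e;
  edge_gt0 : (0 < #|{: edge}|)%N;
  graph_connected : forall u v : vert,
    connect (fun u v => [exists e, [|| (src e == u) && (tgt e == v)
                                     | (src e == v) && (tgt e == u)]]) u v
}.

Section Realization.
Variables (R : realType) (K : metric_graph R).

(* Underlying set of the realization: the vertices, and the points [(e, t)] at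
   distance [t] from [src e] in the interior of [e]. *)
Definition point : Type :=
  (vert K + {p : edge K * R | 0 < p.2 < len p.1})%type.

HB.instance Definition _ := Choice.on point.

Definition vtx (v : vert K) : point := inl v.

(* The gluing map [0, len e] -> K (constant outside of that interval). *)
Definition edge_point (e : edge K) (t : R) : point :=
  if insub (e, t) is Some p then inr p
  else vtx (if t <= 0 then src e else tgt e).

(* [polyline x y L]: there is a path of length [L] from [x] to [y], made of
   finitely many segments, each contained in a closed edge. *)
Inductive polyline : point -> point -> R -> Prop :=
| polyline_nil x : polyline x x 0
| polyline_cons e t t' y L :
    0 <= t <= len e -> 0 <= t' <= len e -> polyline (edge_point e t') y L ->
    polyline (edge_point e t) y (`|t - t'| + L).

Definition pdist (x y : point) : R := inf [set L | polyline x y L].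

(* Oriented edges: [(e, true)] is [e] oriented from [src e] to [tgt e], and
   [(e, false)] is the opposite orientation. *)
Definition dart : Type := (edge K * bool)%type.

HB.instance Definition _ := Finite.on dart.

Definition tail (a : dart) : vert K := if a.2 then src a.1 else tgt a.1.
Definition dlen (a : dart) : R := len a.1.
Definition flip (a : dart) : dart := (a.1, ~~ a.2).

(* The point at distance [t] from the tail of [a] along [a]. *)
Definition dart_point (a : dart) (t : R) : point :=
  edge_point a.1 (if a.2 then t else len a.1 - t).

(* An outgoing unit tangent vector at [x] is encoded by the oriented edge along
   which it points: one with tail [x] if [x] is a vertex (a loop contributes both
   of its orientations), one of the two orientations of the edge containing [x]
   otherwise. *)
Definition outgoing (x : point) (a : dart) : bool :=
  match x with
  | inl v => tail a == v
  | inr p => a.1 == (val p).1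
  end.

Definition tangent (x : point) : Type := {a : dart | outgoing x a}.

HB.instance Definition _ (x : point) := Finite.on (tangent x).

(* Distance from the tail of [a] to [x] along [a], if [outgoing x a]. *)
Definition position (x : point) (a : dart) : R :=
  match x with
  | inl _ => 0
  | inr p => if a.2 then (val p).2 else len (val p).1 - (val p).2
  end.

(* The point [x + s nu], for small [s >= 0]. *)
Definition ray (x : point) (nu : tangent x) (s : R) : point :=
  dart_point (val nu) (position x (val nu) + s).

(* Each linear piece is a closed interval, endpoints included, so that these
   functions are automatically continuous, also at the vertices. *)
Definition Rat (f : point -> R) : Prop :=
  forall e : edge K, exists breaks : seq R,
    forall a b : R, 0 <= a -> a < b -> b <= len e ->
      (forall c, c \in breaks -> ~~ (a < c < b)) ->
      exists m : int, forall t, a <= t <= b ->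
        f (edge_point e t) = f (edge_point e a) + m%:~R * (t - a).

Definition slope (f : point -> R) (x : point) (nu : tangent x) : int :=
  xget 0 [set m : int | exists2 eps : R, 0 < eps &
            forall s, 0 <= s < eps -> f (ray nu s) = f x + m%:~R * s].

Definition divisor : Type := {fsfun point -> int for fun=> 0}.

Definition deg (E : divisor) : int := \sum_(x <- finsupp E) E x.

Definition effective (E : divisor) : Prop := forall x, 0 <= E x.

(* The coefficient at [x] of div(f). *)
Definition ord (f : point -> R) (x : point) : int :=
  - \sum_(nu : tangent x) slope f nu.

End Realization.

Definition isometry (R : realType) (M K : metric_graph R)
    (phi : point M -> point K) : Prop :=
  bijective phi /\ forall x y, pdist (phi x) (phi y) = pdist x y.

(* A model of the realization of [Gamma]: a pair (G, l), together with an
   identification of its realization with that of [Gamma]. *)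
Record model (R : realType) (Gamma : metric_graph R) := Model {
  model_graph :> metric_graph R;
  model_map : point model_graph -> point Gamma;
  model_isometry : isometry model_map
}.

Section Models.
Variables (R : realType) (Gamma : metric_graph R) (M : model Gamma).

Definition model_vertices : set (point Gamma) :=
  [set model_map (vtx v) | v in [set: vert M]].

(* The point of [Gamma] at distance [t] from the tail of [a] along [a]. *)
Definition model_point (a : dart M) (t : R) : point Gamma :=
  model_map (dart_point a t).

Definition points_along (a : dart M) (t : R) (x : point Gamma)
    (nu : tangent x) : Prop :=
  exists2 eps : R, 0 < eps &
    forall s, 0 <= s < eps -> ray nu s = model_point a (t + s).

Definition parallel (a : dart M) (x : point Gamma) (nu : tangent x) : Prop :=
  exists2 t : R, 0 <= t < dlen a & points_along a t nu.

Definition simple_model : Prop :=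
  (forall e : edge M, src e != tgt e) /\
  (forall e e' : edge M,
     [set src e; tgt e]%SET = [set src e'; tgt e']%SET -> e = e').

End Models.

Section RankFunctions.
Variables (r : nat) (I : finType).

Definition cube : Type := {ffun I -> 'I_r.+1}.

Definition cube_axis (i : I) (t : 'I_r.+1) : cube :=
  [ffun j => if j == i then t else ord0].
Definition cube_join (a b : cube) : cube := [ffun i => Order.max (a i) (b i)].
Definition cube_meet (a b : cube) : cube := [ffun i => Order.min (a i) (b i)].

Definition rank_function (rho : cube -> int) : Prop :=
  [/\ forall i t, rho (cube_axis i t) = r%:Z - (t : nat)%:Z,
      forall a b : cube, (forall i, (a i <= b i)%N) -> rho b <= rho a,
      forall a b : cube,
        rho a + rho b <= rho (cube_join a b) + rho (cube_meet a b)
    & forall a : cube, -1 <= rho a <= r%:Z].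

(* [b] stands for [a + e_i], whenever the latter lies in the cube. *)
Definition jump (rho : cube -> int) (a : cube) : Prop :=
  0 <= rho a /\
  forall (i : I) (b : cube), (forall j, b j = (a j + (j == i))%N :> nat) ->
    rho b = rho a - 1.

Definition standard_rank (a : cube) : int :=
  Num.max (-1) (r%:Z - (\sum_(i : I) (a i : nat))%N%:Z).

End RankFunctions.

(* [ss_slopes a i] is the i-th smallest element of S^a.  The rank functions are
   indexed by tangent vectors, and extended to all points of [Gamma]. *)
Record slope_structure (R : realType) (Gamma : metric_graph R) (r : nat) :=
  SlopeStructure {
    ss_model : model Gamma;
    ss_simple : simple_model ss_model;
    ss_slopes : dart ss_model -> 'I_r.+1 -> int;
    ss_increasing : forall a (i j : 'I_r.+1),
      (i < j)%N -> ss_slopes a i < ss_slopes a j;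
    ss_opposite : forall a i,
      ss_slopes a i + ss_slopes (flip a) (rev_ord i) = 0;
    ss_rho : forall x : point Gamma, cube r (tangent x) -> int;
    ss_rank : forall x, model_vertices ss_model x -> rank_function (@ss_rho x);
    ss_standard : forall x, ~ model_vertices ss_model x ->
      @ss_rho x = @standard_rank r (tangent x)
  }.

Section SlopeStructures.
Variables (R : realType) (Gamma : metric_graph R) (r : nat).
Variable S : slope_structure Gamma r.

(* [tangent_slopes nu i] is s_i^nu.  There is exactly one oriented edge parallel
   to [nu], so the default value 0 is never used. *)
Definition tangent_slopes (x : point Gamma) (nu : tangent x) (i : 'I_r.+1) :
    int :=
  if [pick a : dart (ss_model S) | `[< parallel a nu >]] is Some a
  then ss_slopes a i else 0.

Definition cube_slopes (x : point Gamma) (a : cube r (tangent x)) :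
    {ffun tangent x -> int} :=
  [ffun nu => tangent_slopes nu (a nu)].

Definition allowed_slopes (x : point Gamma) : set {ffun tangent x -> int} :=
  [set cube_slopes a | a in jump (@ss_rho _ _ _ S x)].

Definition partial (f : point Gamma -> R) (x : point Gamma) :
    {ffun tangent x -> int} :=
  [ffun nu => slope f nu].

Definition compatible (f : point Gamma -> R) : Prop :=
  forall x : point Gamma,
    (forall nu : tangent x, exists i, slope f nu = tangent_slopes nu i) /\
    allowed_slopes (partial f x).

Definition RatD (D : divisor Gamma) (f : point Gamma -> R) : Prop :=
  [/\ Rat f, compatible f & forall x, 0 <= D x + ord f x].

(* rho_x(partial_x f) >= m.  The point of the cube is unique if it exists, since
   the slopes are strictly increasing. *)
Definition rho_partial_ge (f : point Gamma -> R) (x : point Gamma) (m : int) :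
    Prop :=
  exists2 a : cube r (tangent x), partial f x = cube_slopes a
                                & m <= ss_rho S a.

Definition crude_linear_series (D : divisor Gamma) : Prop :=
  forall E : divisor Gamma, effective E -> deg E = r%:Z ->
    exists f : point Gamma -> R,
      [/\ RatD D f,
          forall x, rho_partial_ge f x (E x)
        & forall x, 0 <= D x + ord f x - E x].

(* The j-th coordinate of the slope vector at the point [x] at distance [t] from
   the tail of [e], in the direction of [e].  For [0 <= t < dlen e], exactly one
   tangent vector at [x] points along [e] at [t], so the default value 0 is not
   used.  The parameter [t] rather than the point is given because, if [e] is a
   loop, its tail and its head are the same point of [Gamma]. *)
Definition slopes_along (G : model Gamma) (e : dart G) (t : R)
    (j : 'I_r.+1) : int :=
  if [pick nu : tangent (model_point e t) | `[< points_along e t nu >]]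
    is Some nu then tangent_slopes nu j else 0.

End SlopeStructures.

(* Main.v *)
(* Along an oriented edge [e] of [G] the slope vector changes only where [e]
   crosses a vertex [x] of the model of [S], so everything reduces to comparing the
   vectors just before and just after [x].  Let [nu], [nu'] be the two tangent
   vectors at [x], and put [j] chips at a nearby point [y] in the direction [nu] and
   [r - j] chips at a nearby point in the direction [nu'].  The rank function at [y]
   is standard, so an [f] given by the crude linear series reaches [y] with slope at
   least s_j^nu; as [D] vanishes inside [e], [f] is concave there, hence
   slope_nu(f) >= s_j^nu, and likewise slope_nu'(f) >= s_(r-j)^nu'.  Concavity at [x]
   yields s_j^nu + s_(r-j)^nu' <= 0, i.e. s_j^nu <= - s_(r-j)^nu', which is the
   j-th slope just before [x].

   Since [G], [Gamma] and the model of [S] are related only by isometries, one also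
   needs that an isometry maps short rays to short rays; this follows from the fact
   that a small ball is a metric star. *)
From Pilot Require Import Defs.
From mathcomp Require Import all_boot all_order all_algebra finmap.
From mathcomp Require Import boolp classical_sets reals lra zify.

Set Implicit Arguments.
Unset Strict Implicit.
Unset Printing Implicit Defensive.

Import Order.TTheory GRing.Theory Num.Theory.
Local Open Scope classical_set_scope.
Local Open Scope ring_scope.

(* mathcomp also exports the names [point], [isometry] and [Rat]. *)
Import Pilot.Defs.

Lemma exists_pos_lt (R : realType) (l : seq R) : all (fun c => 0 < c) l ->
  exists2 d : R, 0 < d & all (fun c => d < c) l.
Proof.
elim: l => [|c l IH] /= => [_|/andP[c0 /IH [d d0 hd]]]; first by exists 1.
have m0 : 0 < Num.min c d by rewrite lt_min c0.
exists (Num.min c d / 2); first by lra.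
have [mc md] : Num.min c d / 2 < c /\ Num.min c d / 2 < d.
  by have := ge_min (Num.min c d) c d; rewrite lexx => /esym /orP; case: (leP c d); lra.
by rewrite mc; apply: sub_all hd => c'; apply: lt_trans.
Qed.

(** * Points, oriented edges and germs of rays in a metric graph *)

Section Metric.
Variables (R : realType) (K : metric_graph R).
Implicit Types (x y z : point K) (a b : dart K) (e : edge K) (s t u : R).

Lemma edge_point_in e t (h : 0 < t < len e) :
  edge_point e t = inr (exist (fun p : edge K * R => 0 < p.2 < len p.1) (e, t) h).
Proof.
rewrite /edge_point; case: insubP => [p _ hp|/=]; last by rewrite h.
by congr inr; apply: val_inj.
Qed.

Lemma edge_point0 e : edge_point e 0 = vtx (src e).
Proof.
by rewrite /edge_point; case: insubP => [p /= /andP[]|_]; rewrite ?ltxx // lexx.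
Qed.

Lemma edge_point_len e : edge_point e (len e) = vtx (tgt e).
Proof.
rewrite /edge_point; case: insubP => [p /= /andP[]|_]; rewrite ?ltxx //.
by rewrite leNgt len_gt0.
Qed.

Lemma flipK a : flip (flip a) = a.
Proof. by case: a => e b; rewrite /flip negbK. Qed.

Lemma dlen_flip a : dlen (flip a) = dlen a.
Proof. by []. Qed.

Lemma dlen_gt0 a : 0 < dlen a.
Proof. exact: len_gt0. Qed.

Lemma dart_point_flip a t : dart_point (flip a) t = dart_point a (dlen a - t).
Proof. by case: a => e [] //=; rewrite /dart_point/dlen/= subKr. Qed.

Lemma dart_point0 a : dart_point a 0 = vtx (tail a).
Proof.
case: a => e []; rewrite /dart_point/tail/=; first exact: edge_point0.
by rewrite subr0 edge_point_len.
Qed.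

Lemma dart_point_interior a t : 0 < t < dlen a ->
  exists p, dart_point a t = inr p /\
    val p = (a.1, if a.2 then t else dlen a - t).
Proof.
rewrite /dart_point/dlen => ht.
have h : 0 < (if a.2 then t else len a.1 - t) < len a.1 by case: a.2; lra.
by rewrite (edge_point_in h); eexists; split.
Qed.

Lemma dart_point_notvtx a t v : 0 < t < dlen a -> dart_point a t <> vtx v.
Proof. by move=> /dart_point_interior[p [-> _]]. Qed.

Lemma dart_point_inj a b t t' : 0 < t < dlen a -> 0 < t' < dlen b ->
  dart_point a t = dart_point b t' ->
  (b = a /\ t' = t) \/ (b = flip a /\ t' = dlen a - t).
Proof.
move=> /dart_point_interior[p [-> vp]] /dart_point_interior[q [-> vq]] [pq].
move: vq; rewrite -pq vp; case: a b {p q pq vp} => [e c] [e' c'] /=.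
rewrite /dlen /flip /= => -[<-].
case: c c' => -[] /=; intros; [left|right|right|left]; split=> //; lra.
Qed.

(** Agreement at interior points leaves equal or opposite darts. Comparing the points at a small [s]
    and at [s / 2] excludes opposite ones, where one parameter would decrease as the other
    increases. *)
Lemma germ_inj a b t t' eps : 0 < eps ->
  0 <= t < dlen a -> 0 <= t' < dlen b ->
  (forall s, 0 <= s < eps -> dart_point a (t + s) = dart_point b (t' + s)) ->
  b = a /\ t' = t.
Proof.
move=> eps0 ht ht' h.
have [|s s0 /= hs] := @exists_pos_lt R [:: eps; dlen a - t; dlen b - t'].
  by rewrite /=; lra.
have /dart_point_inj : dart_point a (t + s) = dart_point b (t' + s) by apply: h; lra.
have /dart_point_inj : dart_point a (t + s/2) = dart_point b (t' + s/2)
  by apply: h; lra.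
move=> [||[-> ?]|[_ ?]]; [lra|lra|by move=> *; split=> //; lra|].
move=> [||[-> ?]|[_ ?]]; [lra|lra|split=> //; lra|lra].
Qed.

Lemma position_bounds x (nu : tangent x) :
  0 <= position x (val nu) < dlen (val nu).
Proof.
case: nu => -[e c]; case: x => [v|[[e' t] /= ht]] /=.
  by rewrite lexx dlen_gt0.
by move=> /eqP ->; rewrite /dlen /=; case: c; lra.
Qed.

Lemma ray0 x (nu : tangent x) : ray nu 0 = x.
Proof.
rewrite /ray addr0; case: nu => a; case: x => [v|[[e' t] /= ht]] /=.
  by move=> /eqP <-; apply: dart_point0.
case: a => e c /= /eqP ->; rewrite /dart_point /=.
have -> : (if c then if c then t else len e' - t
           else len e' - (if c then t else len e' - t)) = t.
  by case: c; rewrite ?subKr.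
exact: edge_point_in.
Qed.

Lemma dart_tangent a t : 0 <= t < dlen a ->
  exists nu : tangent (dart_point a t), forall s, ray nu s = dart_point a (t + s).
Proof.
move=> ht; have [t0|tn0] := eqVneq t 0.
  subst t; rewrite dart_point0.
  have oa : outgoing (vtx (tail a)) a by rewrite /=.
  by exists (exist _ a oa).
have ht' : 0 < t < dlen a by lra.
have [p [-> vp]] := dart_point_interior ht'.
have oa : outgoing (inr p) a by rewrite /= vp.
exists (exist _ a oa) => s; rewrite /ray /= vp /=.
by case: a.2 => //; rewrite subKr.
Qed.

Lemma ray_inj x (nu nu' : tangent x) eps : 0 < eps ->
  (forall s, 0 <= s < eps -> ray nu s = ray nu' s) -> nu = nu'.
Proof.
move=> eps0 h; apply: val_inj.
by have [] := germ_inj eps0 (position_bounds nu) (position_bounds nu') h.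
Qed.

(** * Test functions for the path metric, and small stars *)

Definition edge_lipschitz (F : point K -> R) := forall e t t',
  0 <= t <= len e -> 0 <= t' <= len e ->
  `|F (edge_point e t) - F (edge_point e t')| <= `|t - t'|.

Lemma polyline_lipschitz F x y L :
  edge_lipschitz F -> polyline x y L -> `|F x - F y| <= L.
Proof.
move=> lipF; elim=> [z|e t t' z L' ht ht' _ IH]; first by rewrite subrr normr0.
apply: le_trans (ler_distD (F (edge_point e t')) _ _) _.
by apply: lerD => //; apply: lipF.
Qed.

Lemma polyline_ge0 x y L : polyline x y L -> 0 <= L.
Proof. by elim=> // *; apply: addr_ge0. Qed.

Lemma pdist_le x y L : polyline x y L -> pdist x y <= L.
Proof.
move=> h; apply: ge_inf => //; exists 0 => l /=; exact: polyline_ge0.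
Qed.

(** The polyline makes the set of lengths nonempty; the infimum of the empty set is 0 and would give
    no bound. *)
Lemma pdist_lipschitz F x y L : edge_lipschitz F -> polyline x y L ->
  `|F x - F y| <= pdist x y.
Proof.
move=> lipF h; apply: lb_le_inf; first by exists L.
by move=> l /=; apply: polyline_lipschitz.
Qed.

Lemma pdist_gt0_polyline x y : 0 < pdist x y -> exists L, polyline x y L.
Proof.
move=> h; apply: contrapT => /forallNP nL; move: h; rewrite /pdist.
have -> : [set L | polyline x y L] = set0 by apply/seteqP; split => // l /nL.
by rewrite inf0 ltxx.
Qed.

Lemma polyline_dart a t t' y L : 0 <= t <= dlen a -> 0 <= t' <= dlen a ->
  polyline (dart_point a t') y L ->
  polyline (dart_point a t) y (`|t - t'| + L).
Proof.
rewrite /dlen /dart_point; case: a => e [] /= ht ht' h; first exact: polyline_cons.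
have -> : `|t - t'| = `|(len e - t) - (len e - t')|.
  by rewrite distrC; congr `| _ |; lra.
apply: polyline_cons => //; lra.
Qed.

Lemma polyline_ray x (nu : tangent x) s s' y L :
  0 <= s < dlen (val nu) - position x (val nu) ->
  0 <= s' < dlen (val nu) - position x (val nu) ->
  polyline (ray nu s') y L ->
  polyline (ray nu s) y (`|s - s'| + L).
Proof.
have := position_bounds nu; rewrite /ray => *.
have -> : `|s - s'| = `|(position x (val nu) + s) - (position x (val nu) + s')|.
  by congr `| _ |; lra.
apply: polyline_dart => //; lra.
Qed.

Lemma lipschitz_glue (g : R -> R) m u w :
  (forall t t', u <= t <= m -> u <= t' <= m -> `|g t - g t'| <= `|t - t'|) ->
  (forall t t', m <= t <= w -> m <= t' <= w -> `|g t - g t'| <= `|t - t'|) ->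
  forall t t', u <= t <= w -> u <= t' <= w -> `|g t - g t'| <= `|t - t'|.
Proof.
move=> h1 h2.
suff H t t' : t <= t' -> u <= t <= w -> u <= t' <= w -> `|g t - g t'| <= `|t - t'|.
  move=> t t' ht ht'; case: (leP t t') => [/H|/ltW /H]; first exact.
  by rewrite distrC (distrC t); apply.
move=> tt' ht ht'.
have [t'm|mt'] := leP t' m; first by apply: h1; lra.
have [mt|tm] := leP m t; first by apply: h2; lra.
apply: le_trans (ler_distD (g m) _ _) _.
have := h1 t m ltac:(lra) ltac:(lra); have := h2 m t' ltac:(lra) ltac:(lra).
rewrite (ler0_norm (x := t - m)) ?(ler0_norm (x := m - t'));
  rewrite ?(ler0_norm (x := t - t')); lra.
Qed.

Lemma finite_pos_lb (T : finType) (g : T -> R) : (forall i, 0 < g i) ->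
  exists2 eps, 0 < eps & forall i, eps <= g i.
Proof.
move=> g0; exists (\big[Num.min/1]_i g i).
  by apply/bigmin_gtP; split.
by move=> i; apply: bigmin_le_cond.
Qed.

Lemma edge_point_cases e t : 0 <= t <= len e ->
  [\/ t = 0, t = len e | 0 < t < len e].
Proof.
move=> ht; have [->|t0] := eqVneq t 0; first exact: Or31.
have [->|t1] := eqVneq t (len e); first exact: Or32.
by apply: Or33; lra.
Qed.

(* [h a s] prescribes the value of [F] at distance [s] from [x] in the direction
   of [a], and [k] its value outside of the star of radius [eps] around [x]. *)
Lemma star_function x : exists2 eps : R, 0 < eps &
  forall (h : dart K -> R -> R) (h0 k : R), (forall a, h a 0 = h0) ->
    (forall a s, eps <= s -> h a s = k) ->
    (forall a s s', 0 <= s -> 0 <= s' -> `|h a s - h a s'| <= `|s - s'|) ->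
  exists F, [/\ edge_lipschitz F, F x = h0,
    forall (nu : tangent x) s, 0 <= s < eps ->
      s < dlen (val nu) - position x (val nu) /\ F (ray nu s) = h (val nu) s
  & forall z, F z <> k -> z = x \/
      exists (nu : tangent x) s, 0 <= s < eps /\ z = ray nu s].
Proof.
case: x => [v|[[e0 t0] /= ht0]].
  (* With a radius of at most half of every edge, the branches at [v] do not overlap, not even the
     two orientations of a loop. *)
  have [e|eps eps0 heps] := @finite_pos_lb (edge K) (fun e => len e / 2).
    by have := len_gt0 e; lra.
  exists eps => // h h0 k hh0 hk hlip.
  pose g e t := if t <= len e / 2 then if src e == v then h (e, true) t else k
                else if tgt e == v then h (e, false) (len e - t) else k.
  pose F (z : point K) := match z with
    | inl w => if w == v then h0 else k
    | inr p => g (val p).1 (val p).2 end.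
  have FE e t : 0 <= t <= len e -> F (edge_point e t) = g e t.
    have le0 := len_gt0 e.
    move=> /edge_point_cases[->|->|ht]; last by rewrite edge_point_in.
      by rewrite edge_point0 /g /= hh0; have -> : 0 <= len e / 2 by lra.
    rewrite edge_point_len /g subrr hh0 /=.
    by rewrite leNgt (_ : len e / 2 < len e) //; lra.
  exists F; split.
  - move=> e t t' ht ht'; rewrite !FE //.
    have le0 := len_gt0 e.
    apply: (@lipschitz_glue _ (len e / 2)) (ht) (ht') => {ht ht' t'}t t' ht ht'.
      rewrite /g; have [-> ->] : t <= len e / 2 /\ t' <= len e / 2 by lra.
      by case: ifP => _; [apply: hlip; lra|rewrite subrr normr0].
    have gE u : len e / 2 <= u <= len e ->
        g e u = if tgt e == v then h (e, false) (len e - u) else k.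
      move=> hu; rewrite /g; case: ifP => // u2.
      have -> : u = len e / 2 by lra.
      by rewrite !hk ?if_same //; have := heps e; lra.
    rewrite !gE //; case: ifP => _; last by rewrite subrr normr0.
    apply: le_trans (hlip _ _ _ _ _) _; [lra|lra|].
    by rewrite (distrC t); have -> : len e - t - (len e - t') = t' - t by lra.
  - by rewrite /= eqxx.
  - case=> -[e c] /= o s hs; rewrite /ray/dart_point/dlen/= subr0.
    have := heps e; have := len_gt0 e => ? ?; split; first lra.
    rewrite add0r FE; last by case: c {o}; lra.
    move: o; rewrite /tail /g; case: c => /= ->.
      by have -> : s <= len e / 2 by lra.
    by case: ifP => [?|_]; [lra|rewrite subKr].
  - case=> [w /=|[[e t] /= ht]]; first by case: eqP => [->|_ []] // _; left.
    rewrite /g; case: ifP => [?|/negbT ?]; case: ifP => [av|_ []] //.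
      have [? _|?] := ltP t eps; last by rewrite hk.
      right; exists (exist _ (e, true) av), t; rewrite /ray /dart_point /= add0r.
      by rewrite (edge_point_in ht); split=> //; lra.
    have [? _|?] := ltP (len e - t) eps; last by rewrite hk.
    right; exists (exist _ (e, false) av), (len e - t); rewrite /ray /dart_point /=.
    by rewrite add0r subKr (edge_point_in ht); split=> //; lra.
(* Around an interior point the star stays inside [e0], so every vertex gets the value [k]. *)
have [|eps eps0 /= heps] := @exists_pos_lt R [:: t0; len e0 - t0].
  by rewrite /=; lra.
exists eps => // h h0 k hh0 hk hlip.
pose g e t := if e == e0 then if t0 <= t then h (e0, true) (t - t0)
              else h (e0, false) (t0 - t) else k.
pose F (z : point K) := match z with
  | inl w => k
  | inr p => g (val p).1 (val p).2 end.
have FE e t : 0 <= t <= len e -> F (edge_point e t) = g e t.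
  move=> /edge_point_cases[->|->|ht]; last by rewrite edge_point_in.
    rewrite edge_point0 /g /=; case: eqP => // _.
    by case: ifP => ?; rewrite hk //; lra.
  rewrite edge_point_len /g /=; case: eqP => // ->.
  by case: ifP => ?; rewrite hk //; lra.
exists F; split.
- move=> e t t' ht ht'; rewrite !FE //.
  have [ee|ne] := eqVneq e e0; last by rewrite /g (negPf ne) subrr normr0.
  rewrite ee in ht ht' *.
  apply: (@lipschitz_glue (g e0) t0 0 (len e0)) (ht) (ht') => {ht ht' t'}t t' ht ht'.
    have gE u : 0 <= u <= t0 -> g e0 u = h (e0, false) (t0 - u).
      move=> hu; rewrite /g eqxx; case: ifP => // u2.
      have -> : u = t0 by lra.
      by rewrite subrr !hh0.
    rewrite !gE //; apply: le_trans (hlip _ _ _ _ _) _; [lra|lra|].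
    by rewrite (distrC t); have -> : t0 - t - (t0 - t') = t' - t by lra.
  rewrite /g eqxx; have [-> ->] : t0 <= t /\ t0 <= t' by lra.
  apply: le_trans (hlip _ _ _ _ _) _; [lra|lra|].
  by have -> : t - t0 - (t' - t0) = t - t' by lra.
- by rewrite /= /g eqxx lexx subrr hh0.
- case=> -[e c] /= o s hs; rewrite /ray/dart_point/dlen/=.
  rewrite (eqP o) {e o}.
  split; first by case: c; lra.
  rewrite FE; last by case: c; lra.
  rewrite /g eqxx; case: c.
    have -> : t0 <= t0 + s by lra.
    by rewrite addrAC subrr add0r.
  have -> : len e0 - (len e0 - t0 + s) = t0 - s by lra.
  case: ifP => [?|_]; last by rewrite subKr.
  have -> : s = 0 by lra.
  by rewrite subr0 subrr !hh0.
- case=> [w //|[[e t] /= ht]]; rewrite /g.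
  case: eqP ht => [-> ht|_ ? []] //.
  have o c : outgoing
      (inr (exist (fun p : edge K * R => 0 < p.2 < len p.1) (e0, t0) ht0)) (e0, c).
    exact: eqxx.
  case: ifP => [?|/negbT ?].
    have [? _|?] := ltP (t - t0) eps; last by rewrite hk.
    right; exists (exist _ (e0, true) (o true)), (t - t0); rewrite /ray /dart_point /=.
    have -> : t0 + (t - t0) = t by lra.
    by rewrite (edge_point_in ht); split=> //; lra.
  have [? _|?] := ltP (t0 - t) eps; last by rewrite hk //; lra.
  right; exists (exist _ (e0, false) (o false)), (t0 - t); rewrite /ray /dart_point /=.
  have -> : len e0 - (len e0 - t0 + (t0 - t)) = t by lra.
  by rewrite (edge_point_in ht); split=> //; lra.
Qed.

Lemma ray_dist_le x (nu : tangent x) s s' :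
  0 <= s < dlen (val nu) - position x (val nu) ->
  0 <= s' < dlen (val nu) - position x (val nu) ->
  pdist (ray nu s) (ray nu s') <= `|s - s'|.
Proof.
move=> hs hs'; apply: pdist_le; rewrite -(addr0 `|s - s'|).
by apply: polyline_ray => //; apply: polyline_nil.
Qed.

Lemma min_lipschitz (c s s' : R) : `|Num.min c s - Num.min c s'| <= `|s - s'|.
Proof.
rewrite /Num.min; case: (lerP s s') => ?;
  do ?[case: ifP => ?]; rewrite ler_norml; lra.
Qed.

(** The descent back to 0 at [c] lets the bump and its negative, put on different branches, both
    join the constant 0 outside the star. *)
Definition tent (c s : R) :=
  if s <= c / 2 then s else if s <= c then c - s else 0.

Lemma tent_lipschitz c s s' : 0 <= s -> 0 <= s' ->
  `|tent c s - tent c s'| <= `|s - s'|.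
Proof.
rewrite /tent => s0 s0'; case: (lerP s s') => ?;
  do ?[case: ifP => ?]; rewrite ler_norml; lra.
Qed.

(* Lower bounds for [pdist] come from functions that are 1-Lipschitz on edges: the
   distance to [x] cut off at [eps], and tents with opposite signs on two rays. *)
Lemma star_metric x : exists2 eps : R, 0 < eps &
  [/\ forall (nu : tangent x) s, 0 <= s < eps -> pdist x (ray nu s) = s,
      forall (nu : tangent x) s s', 0 <= s < eps -> 0 <= s' < eps ->
        pdist (ray nu s) (ray nu s') <= `|s - s'|,
      forall (nu nu' : tangent x) s s', nu != nu' ->
        0 <= s < eps -> 0 <= s' < eps ->
        s + s' <= pdist (ray nu s) (ray nu' s')
    & forall y, 0 < pdist x y < eps -> exists nu : tangent x, y = ray nu (pdist x y)].
Proof.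
have [eps eps0 H] := star_function x.
have zeps : 0 <= (0 : R) < eps by rewrite lexx.
have minh0 : Num.min eps 0 = 0 by rewrite min_r // ltW.
have minhk s : eps <= s -> Num.min eps s = eps by move=> ?; apply: min_l.
have minhl s1 s2 : 0 <= s1 -> 0 <= s2 ->
    `|Num.min eps s1 - Num.min eps s2| <= `|s1 - s2|.
  by move=> _ _; apply: min_lipschitz.
have [F [lipF Fx Fray Fk]] :=
  H (fun _ => Num.min eps) 0 eps (fun _ => minh0) (fun _ => minhk) (fun _ => minhl).
have lenE (nu : tangent x) s : 0 <= s < eps ->
    0 <= s < dlen (val nu) - position x (val nu).
  by move=> hs; rewrite (proj1 (Fray nu s hs)); case/andP: hs => ->.
have dle (nu : tangent x) s s' : 0 <= s < eps -> 0 <= s' < eps ->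
    pdist (ray nu s) (ray nu s') <= `|s - s'|.
  by move=> hs hs'; apply: ray_dist_le; apply: lenE.
have poly (nu : tangent x) s y L : 0 <= s < eps ->
    polyline (ray nu s) y L -> polyline x y (s + L).
  move=> hs h; rewrite -{1}(ray0 nu).
  have -> : s + L = `|0 - s| + L by rewrite sub0r normrN ger0_norm //; case/andP: hs.
  by apply: polyline_ray => //; apply: lenE.
have poly' (nu : tangent x) s y L : 0 <= s < eps ->
    polyline x y L -> polyline (ray nu s) y (s + L).
  move=> hs h.
  have -> : s + L = `|s - 0| + L by rewrite subr0 ger0_norm //; case/andP: hs.
  by apply: polyline_ray; rewrite ?ray0 //; apply: lenE.
have distx (nu : tangent x) s : 0 <= s < eps -> pdist x (ray nu s) = s.
  move=> hs; apply/eqP; rewrite eq_le; apply/andP; split.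
    have := dle nu 0 s ltac:(lra) hs; rewrite ray0 sub0r normrN ger0_norm //; lra.
  have := pdist_lipschitz lipF (poly nu s _ 0 hs (polyline_nil _)).
  by rewrite Fx (proj2 (Fray nu s hs)) sub0r normrN ger0_norm; rewrite min_r; lra.
(* A tent of width [eps] measures the distance only up to [eps / 2]. *)
exists (eps / 2); first by lra.
split=> [nu s hs|nu s s' hs hs'|nu nu' s s' nn' hs hs'|y hy].
- by apply: distx; lra.
- by apply: dle; lra.
- pose h a s := if a == val nu then tent eps s else - tent eps s.
  have t0 : tent eps 0 = 0 by rewrite /tent; do ?[case: ifP]; lra.
  have tk u : eps <= u -> tent eps u = 0 by rewrite /tent; do ?[case: ifP]; lra.
  have ts u : 0 <= u < eps / 2 -> tent eps u = u by rewrite /tent; do ?[case: ifP]; lra.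
  have [|||G [lipG _ Gray _]] := H h 0 0.
  + by move=> a; rewrite /h t0 oppr0 if_same.
  + by move=> a u hu; rewrite /h tk // oppr0 if_same.
  + move=> a u u' u0 u0'; rewrite /h; case: ifP => _; first exact: tent_lipschitz.
    by rewrite -opprD normrN; apply: tent_lipschitz.
  have hL : polyline (ray nu s) (ray nu' s') (s + (s' + 0)).
    by apply: poly'; [lra|apply: poly; [lra|apply: polyline_nil]].
  have := pdist_lipschitz lipG hL.
  have hs2 : 0 <= s < eps by lra.
  have hs2' : 0 <= s' < eps by lra.
  rewrite (proj2 (Gray nu s hs2)) (proj2 (Gray nu' s' hs2')).
  rewrite /h eqxx eq_sym (negPf (_ : val nu != val nu')) //.
  by rewrite !ts // opprK ger0_norm //; lra.
- have [L hL] := pdist_gt0_polyline (proj1 (andP hy)).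
  have := pdist_lipschitz lipF hL.
  (* The value [eps] would force [eps <= pdist x y]; any other value puts [y] in the star. *)
  have [->|/eqP] := eqVneq (F y) eps; first by rewrite Fx sub0r normrN gtr0_norm; lra.
  move=> /Fk[yx|[nu [s [hs yE]]]].
    move: hy; rewrite yx; have := pdist_le (polyline_nil x); lra.
  by exists nu; rewrite yE distx.
Qed.

(** * Isometries and short rays *)

Lemma isometry_inv (L : metric_graph R) (phi : point K -> point L)
    (psi : point L -> point K) :
  isometry phi -> cancel phi psi -> cancel psi phi -> isometry psi.
Proof.
move=> [_ isophi] c1 c2; split; first by exists phi.
by move=> x y; rewrite -[in RHS](c2 x) -[in RHS](c2 y) isophi.
Qed.

End Metric.

(* The image of a ray lies in a star around [phi x]; it stays on one branch, since
   points at distances [s], [s'] from [x] on distinct branches are [s + s'] apart. *)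
Lemma isometry_ray (R : realType) (K L : metric_graph R)
    (phi : point K -> point L) (x : point K) (mu : tangent x) :
  isometry phi ->
  exists nu : tangent (phi x), exists2 eps : R, 0 < eps &
    forall s, 0 <= s < eps -> ray nu s = phi (ray mu s).
Proof.
move=> [_ iso].
have [e1 e1_gt0 [dK dK2 _ _]] := star_metric x.
have [e2 e2_gt0 [dL _ dL3 dL4]] := star_metric (phi x).
have [|eps eps0 /= eps12] := @exists_pos_lt R [:: e1; e2].
  by rewrite /= e1_gt0 e2_gt0.
have ex s : 0 < s < eps -> exists nu : tangent (phi x), phi (ray mu s) = ray nu s.
  move=> hs; have ds : pdist (phi x) (phi (ray mu s)) = s by rewrite iso dK; lra.
  by have [|nu] := dL4 (phi (ray mu s)); rewrite ds; [lra|exists nu].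
(* The branch containing the image of the point at [eps / 2] serves as reference for all other
   [s]. *)
have [|nu0 nu0E] := ex (eps / 2); first by lra.
exists nu0, eps => // s hs.
have [->|s0] := eqVneq s 0; first by rewrite !ray0.
have [|nu nuE] := ex s; first by lra.
have [->|ne] := eqVneq nu0 nu; first by rewrite nuE.
exfalso.
have := dL3 _ _ (eps / 2) s ne ltac:(lra) ltac:(lra).
rewrite -nu0E -nuE iso => h.
have := le_trans h (dK2 mu (eps / 2) s ltac:(lra) ltac:(lra)).
by case: (lerP (eps / 2) s); lra.
Qed.

(** * Real induction and one-sided slopes of functions of one variable *)

Section RealInduction.
Variable R : realType.
Implicit Types (a b s t u : R) (phi : R -> R) (m : int).

(** Real induction: [c] is the supremum of the [u] up to which [g] stays at most [g t]. The
    condition on the left of [c] extends the bound to [c], and the one on its right extends it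
    beyond [c] unless [c = t']. *)
Lemma nonincreasing_of_local (g : R -> int) a b :
  (forall t, a <= t < b -> exists2 eps : R, 0 < eps &
     forall s, 0 < s < eps -> t + s < b -> g (t + s) <= g t) ->
  (forall t, a < t < b -> exists2 eps : R, 0 < eps &
     forall s, 0 < s < eps -> a <= t - s -> g t <= g (t - s)) ->
  forall t t', a <= t -> t <= t' -> t' < b -> g t' <= g t.
Proof.
move=> gr gl t t' at_ tt' t'b.
pose A := [set u | t <= u <= t' /\ forall w : R, t <= w <= u -> g w <= g t].
have At : A t.
  split; first by rewrite lexx.
  by move=> w hw; have -> : w = t by lra.
have ubA : ubound A t' by move=> u [] /andP[].
have supA : has_sup A by split; [exists t | exists t'].
pose c := sup A.
have tc : t <= c by apply: ub_le_sup At; exists t'.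
have ct' : c <= t' by apply: ge_sup => //; exists t.
have lt_c w : t <= w < c -> g w <= g t.
  move=> hw; have [|u Au] := @sup_adherent _ A (c - w) _ supA; first lra.
  rewrite /= -/c => hu; case: Au => _; apply; lra.
have gc : g c <= g t.
  have [->//|ne] := eqVneq c t.
  have [|eps eps0 h] := gl c; first lra.
  have [|s s0 /= hs] := @exists_pos_lt R [:: eps; c - t]; first by rewrite /=; lra.
  apply: (le_trans (h s _ _)); [lra|lra|apply: lt_c; lra].
have [<-//|ne] := eqVneq c t'; exfalso.
have [|eps eps0 h] := gr c; first lra.
have [|s s0 /= hs] := @exists_pos_lt R [:: eps; t' - c]; first by rewrite /=; lra.
suff : A (c + s) by move=> /(ub_le_sup (ex_intro _ t' ubA)); rewrite -/c; lra.
split; first lra.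
move=> w hw; have [wc|cw] := ltP w c; first by apply: lt_c; lra.
have [->//|ne'] := eqVneq w c.
have -> : w = c + (w - c) by lra.
by apply: le_trans gc; apply: h; lra.
Qed.

Definition right_slope phi t m := exists2 eps : R, 0 < eps &
  forall s, 0 <= s < eps -> phi (t + s) = phi t + m%:~R * s.

(** The slope is outgoing, that is, minus the left derivative, as for tangent vectors; concavity
    thus reads [n + n' <= 0] for the right slope [n] and the left slope [n']. *)
Definition left_slope phi t m := exists2 eps : R, 0 < eps &
  forall s, 0 <= s < eps -> phi (t - s) = phi t + m%:~R * s.

Lemma right_slope_inj phi t m m' :
  right_slope phi t m -> right_slope phi t m' -> m = m'.
Proof.
move=> [e1 e10 h1] [e2 e20 h2].
have [|s s0 /= hs] := @exists_pos_lt R [:: e1; e2]; first by rewrite /= e10 e20.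
have := h1 s ltac:(lra); rewrite h2; last lra.
have sn0 : s != 0 by rewrite gt_eqF.
by move=> /addrI /(mulIf sn0) /intr_inj.
Qed.

Lemma right_slope_shift phi t m : right_slope phi t m ->
  exists2 eps : R, 0 < eps & forall s, 0 <= s < eps -> right_slope phi (t + s) m.
Proof.
move=> [eps eps0 h]; exists eps => // s hs; exists (eps - s); first lra.
by move=> s' hs'; rewrite -addrA !h ?mulrDr ?addrA //; lra.
Qed.

Lemma left_slope_shift phi t m : left_slope phi t m ->
  exists2 eps : R, 0 < eps &
    forall s, 0 < s < eps -> right_slope phi (t - s) (- m).
Proof.
move=> [eps eps0 h]; exists eps => // s hs; exists s; first lra.
move=> s' hs'; have -> : t - s + s' = t - (s - s') by lra.
by rewrite !h ?mulrNz; lra.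
Qed.

(** The right slope is non-increasing by real induction; it is [m] at [a] and [- m'] just before
    [b]. *)
Lemma concave_slopes phi a b m m' : a < b ->
  (forall t, a < t < b -> exists n n',
     [/\ right_slope phi t n, left_slope phi t n' & n + n' <= 0]) ->
  right_slope phi a m -> left_slope phi b m' -> 0 <= m + m'.
Proof.
move=> ab H ra lb.
(* The default 0 is never reached on [[a, b)], where a right slope always exists. *)
pose g t := xget 0 (right_slope phi t).
have gE t n : right_slope phi t n -> g t = n.
  move=> h; apply: (right_slope_inj _ h).
  by apply: (@xgetPex _ 0 (right_slope phi t)); exists n.
have [eps eps0 hb] := left_slope_shift lb.
have [|s s0 /= hs] := @exists_pos_lt R [:: eps; b - a]; first by rewrite /=; lra.
have : g (b - s) <= g a.
  apply: (@nonincreasing_of_local g a b); [| |lra|lra|lra].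
    move=> t ht; have [n rn] : exists n, right_slope phi t n.
      have [->|ne] := eqVneq t a; first by exists m.
      by have [|n [_ [rn _ _]]] := H t; [lra|exists n].
    have [e e0 h] := right_slope_shift rn; exists e => // u hu _.
    by rewrite (gE _ _ rn) (gE _ n) //; apply: h; lra.
  move=> t ht; have [|n [n' [rn ln nn']]] := H t; first lra.
  have [e e0 h] := left_slope_shift ln; exists e => // u hu _.
  by rewrite (gE _ _ rn) (gE _ _ (h u hu)); lra.
rewrite (gE _ _ ra) (gE _ _ (hb s _)); lra.
Qed.

End RealInduction.

(** * Comparison of germs in several models of the same graph *)

Section ModelGerms.
Variables (R : realType) (Gamma : metric_graph R).
Implicit Types (s t u : R) (x : point Gamma).

Lemma points_along_ex (M : model Gamma) (a : dart M) t x :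
  0 <= t < dlen a -> x = model_point a t ->
  exists nu : tangent x, points_along a t nu.
Proof.
move=> ht ->; have [mu muE] := dart_tangent ht.
have [nu [eps eps0 nuE]] := isometry_ray mu (model_isometry M).
by exists nu, eps => // s hs; rewrite nuE // muE.
Qed.

(** The inverse of [model_map] is also an isometry, so [mu] pulls back to a ray of the model, and a
    ray runs along a dart by construction. *)
Lemma tangent_points_along (M : model Gamma) x (mu : tangent x) :
  exists (a : dart M) t, 0 <= t < dlen a /\ points_along a t mu.
Proof.
have [psi c1 c2] := (model_isometry M).1.
have [nu [eps eps0 nuE]] := isometry_ray mu (isometry_inv (model_isometry M) c1 c2).
exists (val nu), (position (psi x) (val nu)); split; first exact: position_bounds.
by exists eps => // s hs; rewrite /model_point -[dart_point _ _]/(ray nu s) nuE // c2.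
Qed.

Lemma points_along_base (M : model Gamma) (a : dart M) t x (nu : tangent x) :
  points_along a t nu -> x = model_point a t.
Proof. by move=> [eps eps0 h]; rewrite -(ray0 nu) h ?lexx // addr0. Qed.

Lemma points_along_inj (M : model Gamma) (a : dart M) t x (nu nu' : tangent x) :
  points_along a t nu -> points_along a t nu' -> nu = nu'.
Proof.
move=> [e1 e10 h1] [e2 e20 h2].
apply: (@ray_inj _ _ _ _ _ (Num.min e1 e2)); first by rewrite lt_min e10.
by move=> s /andP[s0]; rewrite lt_min => /andP[s1 s2]; rewrite h1 ?h2 ?s0.
Qed.

Lemma points_along_dart_inj (M : model Gamma) (a b : dart M) t u x (nu : tangent x) :
  0 <= t < dlen a -> 0 <= u < dlen b ->
  points_along a t nu -> points_along b u nu -> b = a /\ u = t.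
Proof.
move=> ht hu [e1 e10 h1] [e2 e20 h2].
apply: (@germ_inj _ _ _ _ _ _ (Num.min e1 e2)) => //; first by rewrite lt_min e10.
move=> s /andP[s0]; rewrite lt_min => /andP[s1 s2].
by apply: (bij_inj (model_isometry M).1); rewrite -[LHS]h1 -?[RHS]h2 ?s0.
Qed.

Lemma model_point_flip (M : model Gamma) (a : dart M) t :
  model_point (flip a) t = model_point a (dlen a - t).
Proof. by rewrite /model_point dart_point_flip. Qed.

Lemma model_point_notvtx (M : model Gamma) (a : dart M) t :
  0 < t < dlen a -> ~ model_vertices M (model_point a t).
Proof.
move=> ht [v _ /(bij_inj (model_isometry M).1) /esym].
exact: dart_point_notvtx.
Qed.

(** The point may be a vertex of [Gamma], so its tangent vectors are counted in [M]: each one pulls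
    back to a dart through an interior point of an edge, which leaves the two orientations. *)
Lemma interior_tangents (M : model Gamma) (a : dart M) t x :
  0 < t < dlen a -> x = model_point a t ->
  exists nu nu' : tangent x,
    [/\ points_along a t nu, points_along (flip a) (dlen a - t) nu',
        nu != nu' & forall mu, mu = nu \/ mu = nu'].
Proof.
move=> ht xE.
have ht1 : 0 <= t < dlen a by lra.
have ht2 : 0 <= dlen a - t < dlen (flip a) by rewrite dlen_flip; lra.
have [nu nuE] := points_along_ex ht1 xE.
have [|nu' nuE'] := @points_along_ex M (flip a) (dlen a - t) x ht2.
  by rewrite model_point_flip subKr.
exists nu, nu'; split=> //.
  apply/eqP => nn; rewrite -nn in nuE'.
  have [] := points_along_dart_inj ht1 ht2 nuE nuE'.
  by case: (a) => e c; rewrite /flip /=; case: c.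
move=> mu; have [b [u [hu muE]]] := tangent_points_along M mu.
have := etrans (esym xE) (points_along_base muE) => /(bij_inj (model_isometry M).1).
have [u0|u0] := eqVneq u 0.
  by rewrite u0 dart_point0 => at_vtx; case: (dart_point_notvtx ht at_vtx).
move=> /(dart_point_inj ht) []; first lra.
  by move=> [ba ut]; left; subst; apply: points_along_inj nuE.
by move=> [ba ut]; right; subst; apply: points_along_inj nuE'.
Qed.

(** Darts of different models are compared through the points of [Gamma] that they trace; the
    explicit radius allows moving and reversing the germ. *)
Definition germ_eq (M N : model Gamma) (a : dart M) t (b : dart N) u (eps : R) :=
  forall s, 0 <= s < eps -> model_point a (t + s) = model_point b (u + s).

Lemma germ_ex (M N : model Gamma) (a : dart M) t : 0 <= t < dlen a ->
  exists (b : dart N) u, 0 <= u < dlen b /\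
    exists2 eps, 0 < eps & germ_eq a t b u eps.
Proof.
move=> ht; have [nu [e1 e10 h1]] := points_along_ex ht erefl.
have [b [u [hu [e2 e20 h2]]]] := tangent_points_along N nu.
exists b, u; split=> //; exists (Num.min e1 e2); first by rewrite lt_min e10.
move=> s /andP[s0]; rewrite lt_min => /andP[s1 s2].
by rewrite -h1 ?h2 ?s0.
Qed.

Lemma points_along_germ (M N : model Gamma) (a : dart M) t (b : dart N) u eps
    x (nu : tangent x) : 0 < eps -> germ_eq a t b u eps ->
  points_along a t nu -> points_along b u nu.
Proof.
move=> eps0 h [e e0 h'].
exists (Num.min e eps); first by rewrite lt_min e0.
move=> s /andP[s0]; rewrite lt_min => /andP[s1 s2].
by rewrite h' ?h ?s0.
Qed.

Lemma germ_eq_shift (M N : model Gamma) (a : dart M) t (b : dart N) u eps d :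
  germ_eq a t b u eps -> 0 <= d -> germ_eq a (t + d) b (u + d) (eps - d).
Proof. by move=> h d0 s hs; rewrite -!addrA h //; lra. Qed.

Lemma germ_eq_flip (M N : model Gamma) (a : dart M) t (b : dart N) u eps d :
  germ_eq a t b u eps -> 0 < d < eps ->
  germ_eq (flip a) (dlen a - (t + d)) (flip b) (dlen b - (u + d)) d.
Proof.
move=> h hd s hs; rewrite !model_point_flip.
have -> : dlen a - (dlen a - (t + d) + s) = t + (d - s) by lra.
have -> : dlen b - (dlen b - (u + d) + s) = u + (d - s) by lra.
by apply: h; lra.
Qed.

End ModelGerms.

(** * Slopes of piecewise affine functions along edges *)

Section Functions.
Variables (R : realType) (Gamma : metric_graph R).
Implicit Types (s t u : R) (x : point Gamma) (f : point Gamma -> R).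

(** The case [c = p] stays allowed: a break at the end of a linear piece is harmless. *)
Lemma isolated_from_seq (l : seq R) (p : R) : exists2 eps : R, 0 < eps &
  forall c, c \in l -> ~~ (p < c < p + eps) /\ ~~ (p - eps < c < p).
Proof.
elim: l => [|c l [eps eps0 IH]]; first by exists 1.
pose d := if c == p then eps else Num.min eps `|c - p|.
have cp : c != p -> 0 < `|c - p| by rewrite normr_gt0 subr_eq0.
have [d0 deps] : 0 < d /\ d <= eps.
  by rewrite /d; case: eqVneq => [_|/cp h]; rewrite ?lexx // lt_min ge_min eps0 h lexx.
exists d => // c'; rewrite inE => /orP[/eqP ->|/IH [h1 h2]]; last by lra.
rewrite /d; case: eqVneq => [->|_]; first by lra.
by rewrite /Num.min; case: (lerP c p) => ?; case: ifP; lra.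
Qed.

Lemma Rat_affine_ray f x (nu : tangent x) : Rat f ->
  exists m : int, exists2 eps : R, 0 < eps &
    forall s, 0 <= s < eps -> f (ray nu s) = f x + m%:~R * s.
Proof.
move=> Rf; have hp := position_bounds nu; have := ray0 nu.
move: hp; rewrite /ray /dart_point /dlen.
case: (val nu) => e c /=; have [l hl] := Rf e.
set p := position _ _ => hp.
case: c @p hp => p hp; rewrite addr0 => xE.
  have [eps eps0 iso] := isolated_from_seq l p.
  pose b := Num.min (p + eps) (len e).
  have hb : [/\ p < b, b <= len e & b <= p + eps].
    by rewrite /b; split; rewrite /Num.min; case: ifP; lra.
  case: hb => b1 b2 b3.
  have [||||m hm] := hl p b; [lra|lra|lra| |].
    by move=> c /iso []; lra.
  exists m, (b - p); first lra.
  move=> s hs; rewrite hm; last lra.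
  by rewrite xE; congr (_ + _ * _); lra.
(* Against the reference orientation the ray decreases the parameter from [q], hence the sign change
   of the slope below. *)
set q := len e - p in xE.
have [eps eps0 iso] := isolated_from_seq l q.
pose b := Num.max (q - eps) 0.
have hb : [/\ b < q, 0 <= b & q - eps <= b].
  by rewrite /b /q; split; rewrite /Num.max; case: ifP; lra.
case: hb => b1 b2 b3.
have [||||m hm] := hl b q; [lra|lra|rewrite /q; lra| |].
  by move=> c /iso []; lra.
exists (- m), (q - b); first lra.
move=> s hs; have -> : len e - (p + s) = q - s by rewrite /q; lra.
rewrite -xE (hm q) ?(hm (q - s)); [|lra|lra].
by rewrite mulrNz; lra.
Qed.

(** The default value in [slope] is not reached, since [f] is affine near the start of every ray. *)
Lemma slope_ray f x (nu : tangent x) : Rat f -> exists2 eps : R, 0 < eps &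
  forall s, 0 <= s < eps -> f (ray nu s) = f x + (slope f nu)%:~R * s.
Proof.
move=> Rf; have [m hm] := Rat_affine_ray nu Rf.
by rewrite /slope; apply: (@xgetPex _ 0 [set m : int | exists2 eps : R, 0 < eps &
  forall s, 0 <= s < eps -> f (ray nu s) = f x + m%:~R * s]); exists m.
Qed.

Lemma right_slope_along (M : model Gamma) (a : dart M) t f x (nu : tangent x) :
  Rat f -> points_along a t nu ->
  right_slope (fun s => f (model_point a s)) t (slope f nu).
Proof.
move=> Rf nuE; rewrite /right_slope -(points_along_base nuE).
have [e1 e10 h1] := slope_ray nu Rf; have [e2 e20 h2] := nuE.
exists (Num.min e1 e2); first by rewrite lt_min e10.
by move=> s /andP[s0]; rewrite lt_min => /andP[s1 s2]; rewrite -h2 ?h1 ?s0.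
Qed.

Lemma left_slope_along (M : model Gamma) (a : dart M) t f x (nu : tangent x) :
  Rat f -> points_along (flip a) (dlen a - t) nu ->
  left_slope (fun s => f (model_point a s)) t (slope f nu).
Proof.
move=> Rf /(right_slope_along Rf) [eps eps0 h]; exists eps => // s /h.
rewrite !model_point_flip.
have -> : dlen a - (dlen a - t + s) = t - s by lra.
by rewrite subKr.
Qed.

Lemma ord_two f x (nu nu' : tangent x) : nu != nu' ->
  (forall mu, mu = nu \/ mu = nu') -> ord f x = - (slope f nu + slope f nu').
Proof.
move=> nn all2; rewrite /ord (bigD1 nu) //= (bigD1 nu') /=; last by rewrite eq_sym.
rewrite big_pred0 ?addr0 // => mu.
by case: (all2 mu) => ->; rewrite eqxx ?andbF.
Qed.

(** At an interior point the two outgoing slopes sum to [- ord], so nonnegative orders make [f]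
    concave along the edge and [concave_slopes] applies. *)
Lemma concave_along (M : model Gamma) (a : dart M) f t u x y
    (nu : tangent x) (nu' : tangent y) :
  Rat f -> 0 <= t -> t < u -> u <= dlen a ->
  (forall s, t < s < u -> 0 <= ord f (model_point a s)) ->
  points_along a t nu -> points_along (flip a) (dlen a - u) nu' ->
  0 <= slope f nu + slope f nu'.
Proof.
move=> Rf t0 tu ul ordf /(right_slope_along Rf) sx /(left_slope_along Rf) sy.
apply: (concave_slopes tu _ sx sy) => s hs.
have hs' : 0 < s < dlen a by lra.
have [mu [mu' [muE muE' mm all2]]] := interior_tangents hs' erefl.
exists (slope f mu), (slope f mu'); split.
- exact: right_slope_along.
- exact: left_slope_along.
- by have := ordf s hs; rewrite (ord_two f mm all2) oppr_ge0.
Qed.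

End Functions.

(** * Slope vectors and rank conditions along an edge *)

Section Slopes.
Variables (R : realType) (Gamma : metric_graph R) (r : nat).
Variable S : slope_structure Gamma r.
Implicit Types (s t u : R) (x : point Gamma) (f : point Gamma -> R).

Lemma tangent_slopesE (a : dart (ss_model S)) u x (nu : tangent x) i :
  0 <= u < dlen a -> points_along a u nu -> tangent_slopes S nu i = ss_slopes a i.
Proof.
move=> hu nuE; rewrite /tangent_slopes; case: pickP => [b /asboolP [t ht bE]|none].
  by have [-> _] := points_along_dart_inj hu ht nuE bE.
have := none a; have -> // : `[< parallel a nu >].
by apply/asboolP; exists u.
Qed.

(** Any tangent vector that [pick] returns points along [e], hence along [a] by the common germ. *)
Lemma slopes_alongE (G : model Gamma) (e : dart G) t (a : dart (ss_model S)) u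
    (eps : R) j : 0 <= t < dlen e -> 0 <= u < dlen a -> 0 < eps ->
  germ_eq e t a u eps -> slopes_along S e t j = ss_slopes a j.
Proof.
move=> ht hu eps0 ge; rewrite /slopes_along.
case: pickP => [nu /asboolP nuE|none].
  by apply: tangent_slopesE hu _; apply: points_along_germ eps0 ge nuE.
have [nu nuE] := points_along_ex ht erefl.
by have := none nu; have -> // : `[< points_along e t nu >] by apply/asboolP.
Qed.

Lemma ss_slopes_le (a : dart (ss_model S)) (i j : 'I_r.+1) :
  (i <= j)%N -> ss_slopes a i <= ss_slopes a j.
Proof.
rewrite leq_eqVlt => /orP[/eqP/val_inj->//|/(ss_increasing a)/ltW //].
Qed.

(* At a point in the interior of an edge of the model of [S] the rank function is
   standard, so [m <= rho] bounds each of the two slope indices by [r - m]. *)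
Lemma interior_slope_le f (a : dart (ss_model S)) u y (mu : tangent y) (k : 'I_r.+1) :
  0 < u < dlen a -> y = model_point a u -> rho_partial_ge S f y (k : nat)%:Z ->
  points_along (flip a) (dlen a - u) mu -> slope f mu <= - ss_slopes a k.
Proof.
move=> hu yE [c cE]; rewrite ss_standard; last by rewrite yE; apply: model_point_notvtx.
(* Of the two terms of the maximum, [-1] is excluded by [0 <= k]. *)
rewrite /standard_rank le_max => /orP[|hc] muE; first by lia.
have -> : slope f mu = ss_slopes (flip a) (c mu).
  move/ffunP: cE => /(_ mu); rewrite !ffunE => ->.
  by apply: tangent_slopesE muE; rewrite dlen_flip; lra.
have := ss_opposite a k.
suff : ss_slopes (flip a) (c mu) <= ss_slopes (flip a) (rev_ord k) by lra.
apply: ss_slopes_le; rewrite /= subSS.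
have : (c mu <= \sum_(i : tangent y) c i)%N by rewrite (bigD1 mu) //= leq_addr.
rewrite lerBrDr -PoszD lez_nat in hc.
by move=> /leq_trans; apply; rewrite leq_subRL -1?ltnS // addnC.
Qed.

(** The rank at the nearby point [t + d] bounds the slope of [f] back towards [x] by
    [- ss_slopes a k]; concavity between the two points carries this over to the slope at [x]. *)
Lemma slope_ge_of_rank (G : model Gamma) (e : dart G) t (a : dart (ss_model S)) u
    (eps d : R) f x (nu : tangent x) (k : 'I_r.+1) :
  Rat f -> (forall s, 0 < s < dlen e -> 0 <= ord f (model_point e s)) ->
  0 <= t -> 0 <= u -> points_along e t nu -> germ_eq e t a u eps ->
  0 < d < eps -> t + d < dlen e -> u + d < dlen a ->
  rho_partial_ge S f (model_point e (t + d)) (k : nat)%:Z ->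
  ss_slopes a k <= slope f nu.
Proof.
move=> Rf ordf t0 u0 nuE ge hd td ud hk.
have yE : model_point e (t + d) = model_point a (u + d) by apply: ge; lra.
have htd : 0 < t + d < dlen e by lra.
have [mu [mu' [_ muE' _ _]]] := interior_tangents htd erefl.
have muE2 : points_along (flip a) (dlen a - (u + d)) mu'.
  by apply: points_along_germ (germ_eq_flip ge hd) muE'; lra.
have hud : 0 < u + d < dlen a by lra.
have h1 := interior_slope_le hud yE hk muE2.
have := @concave_along _ _ G e f t (t + d) _ _ nu mu' Rf t0
  ltac:(lra) ltac:(lra) _ nuE muE'.
have hord : forall s, t < s < t + d -> 0 <= ord f (model_point e s).
  by move=> s hs; apply: ordf; lra.
move=> /(_ hord); lra.
Qed.

End Slopes.

(** * Two chips near a point, and the slopes on its two sides *)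

Lemma two_point_divisor (R : realType) (Gamma : metric_graph R)
    (y z : point Gamma) (k m : nat) : y != z ->
  exists E : divisor Gamma,
    [/\ effective E, deg E = (k + m)%N%:Z, E y = k%:Z & E z = m%:Z].
Proof.
move=> yz; pose g x : int := if x == y then k%:Z else m%:Z.
pose E : divisor Gamma := [fsfun x in [fset y; z]%fset => g x].
have Ey : E y = k%:Z by rewrite fsfunE !inE eqxx /g eqxx.
have Ez : E z = m%:Z by rewrite fsfunE !inE eqxx orbT /g eq_sym (negPf yz).
exists E; split=> //.
  by move=> x; rewrite fsfunE; case: ifP => // _; rewrite /g; case: ifP.
(* As [k] or [m] may be zero, [finsupp E] may be smaller than the two-point set; the additional
   terms vanish. *)
rewrite /deg (big_fset_incl _ (finsupp_sub _ _ _)) => [|x _].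
  by rewrite big_fsetU1 ?inE //= big_seq_fset1 Ey Ez PoszD.
by move/fsfun_dflt.
Qed.

Section CrossingVertex.
Variables (R : realType) (Gamma : metric_graph R) (r : nat) (D : divisor Gamma).
Variables (S : slope_structure Gamma r) (crudeDS : crude_linear_series S D).
Variables (G : model Gamma).
Hypothesis suppD : forall x, D x != 0 -> model_vertices G x.
Implicit Types (s t u : R).

Lemma ord_ge0_along f (e : dart G) s :
  RatD S D f -> 0 < s < dlen e -> 0 <= ord f (model_point e s).
Proof.
move=> [_ _ /(_ (model_point e s))] h hs.
have [D0|/suppD /model_point_notvtx []//] := eqVneq (D (model_point e s)) 0.
by rewrite D0 add0r in h.
Qed.

(* The chips [j] at [t + d] and [r - j] at [t - d] force the outgoing slopes at
   [t] to be at least the [j]-th and the [r - j]-th ones, and the sum of these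
   two slopes is nonpositive since [D] vanishes at [t]. *)
Lemma opposite_slopes_le0 (e : dart G) t (a b : dart (ss_model S)) u u'
    (eps eps' : R) (j : 'I_r.+1) :
  0 < t < dlen e -> 0 <= u < dlen a -> 0 <= u' < dlen b ->
  0 < eps -> 0 < eps' ->
  germ_eq e t a u eps -> germ_eq (flip e) (dlen e - t) b u' eps' ->
  ss_slopes a j + ss_slopes b (rev_ord j) <= 0.
Proof.
move=> ht hu hu' eps0 eps0' ge ge'.
(* Both chips have to stay inside [e], and inside the edges [a] and [b] of the model of [S], where
   the rank function is standard. *)
have [|d d0 /= hd] := @exists_pos_lt R
  [:: eps; eps'; t; dlen e - t; dlen a - u; dlen b - u']; first by rewrite /=; lra.
set y := model_point e (t + d); set z := model_point (flip e) (dlen e - t + d).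
(* In the interior of [e] distinct parameters give distinct points, even if [e] is a loop. *)
have yz : y != z.
  apply/eqP; rewrite /y /z model_point_flip => /(bij_inj (model_isometry G).1).
  move=> /dart_point_inj []; [lra|lra|move=> [_]; lra|].
  by case: (e) => e0 c [[]]; case: c.
have [E [Eeff Edeg Ey Ez]] := two_point_divisor j (r - j) yz.
have [|f [RDf rhof _]] := crudeDS Eeff.
  by rewrite Edeg subnKC // -ltnS.
have [Rf _ _] := RDf.
have [nu [nu' [nuE nuE' nn all2]]] := interior_tangents ht erefl.
have := ord_ge0_along RDf ht; rewrite (ord_two f nn all2) oppr_ge0.
have h1 : ss_slopes a j <= slope f nu.
  apply: (slope_ge_of_rank (d := d) Rf _ _ _ nuE ge) => //; try lra.
    by move=> s; apply: (ord_ge0_along RDf).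
  by rewrite -Ey; apply: rhof.
have h2 : ss_slopes b (rev_ord j) <= slope f nu'.
  apply: (slope_ge_of_rank (d := d) Rf _ _ _ nuE' ge') => //;
    rewrite ?dlen_flip; try lra.
    by move=> s hs; apply: (ord_ge0_along (e := flip e) RDf).
  by rewrite /= subSS -Ez; apply: rhof.
lra.
Qed.

End CrossingVertex.

Theorem proposition4p3 (R : realType) (Gamma : metric_graph R) (r : nat)
    (D : divisor Gamma) (S : slope_structure Gamma r)
    (crudeDS : crude_linear_series S D)
    (G : model Gamma) (suppD : forall x, D x != 0 -> model_vertices G x)
    (e : dart G) :
  (forall t : R, 0 <= t < dlen e ->
     exists2 eps0 : R, 0 < eps0 &
       forall eps : R, 0 < eps < eps0 -> forall j : 'I_r.+1,
         slopes_along S e (t + eps) j <= slopes_along S e t j) /\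
  (forall t t' : R, 0 <= t -> t < t' -> t' < dlen e -> forall j : 'I_r.+1,
     slopes_along S e t' j <= slopes_along S e t j).
Proof.
(* Just after [t] the edge [e] follows a single edge of the model of [S], so the inequality is in
   fact an equality there. *)
have right_const (t : R) : 0 <= t < dlen e -> exists2 eps0 : R, 0 < eps0 &
    forall eps : R, 0 < eps < eps0 -> forall j : 'I_r.+1,
      slopes_along S e (t + eps) j <= slopes_along S e t j.
  move=> ht; have [a [u [hu [eps eps0 ge]]]] := germ_ex (ss_model S) ht.
  have [|d d0 /= hd] := @exists_pos_lt R [:: eps; dlen e - t; dlen a - u].
    by rewrite /=; lra.
  exists d => // s hs j; rewrite (slopes_alongE j ht hu eps0 ge).
  have ge' : germ_eq e (t + s) a (u + s) (eps - s).
    by apply: germ_eq_shift => //; lra.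
  by rewrite (slopes_alongE j _ _ _ ge'); lra.
split=> // t t' t0 tt' t'l j.
(* [right_const] is the condition on the right; the condition on the left is the crossing of a
   possible vertex at [t]. *)
apply: (@nonincreasing_of_local _ (slopes_along S e ^~ j) 0 (dlen e)); [| |lra|lra|lra].
  move=> s /right_const [eps eps0 h]; exists eps => // d hd _; exact: h.
move=> {t t' t0 tt' t'l} t ht.
have ht1 : 0 <= t < dlen e by lra.
have ht2 : 0 <= dlen e - t < dlen (flip e) by rewrite dlen_flip; lra.
have [a [u [hu [eps eps0 ge]]]] := germ_ex (ss_model S) ht1.
have [b [u' [hu' [eps' eps0' ge']]]] := germ_ex (ss_model S) ht2.
have [|d d0 /= hd] := @exists_pos_lt R [:: eps'; dlen b - u'].
  by rewrite /=; lra.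
exists d => // s hs ts; rewrite (slopes_alongE j ht1 hu eps0 ge).
have hs' : 0 < s < eps' by lra.
(* Just before [t] the edge [e] runs along [flip b], whose [j]-th slope is minus the [(r - j)]-th
   slope of [b]. *)
have := germ_eq_flip ge' hs'; rewrite flipK dlen_flip.
have -> : dlen e - (dlen e - t + s) = t - s by lra.
move=> ge2; rewrite (slopes_alongE j _ _ _ ge2) ?dlen_flip; [|lra|lra|lra].
have := opposite_slopes_le0 crudeDS suppD j ht hu hu' eps0 eps0' ge ge'.
have := ss_opposite b (rev_ord j); rewrite rev_ordK; lra.
Qed.
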